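(* Let $T$ be a densely defined positive symmetric operator acting in a real or complex Hilbert space $\mathcal H$. The positive self-adjoint extensions of $T$ form the operator interval $$[T_N,T_F]=\{S=S^*:\ T_N\preceq S\preceq T_F\},$$ where $T_N=J_T^{**}J_T^*$ is the Krein-von Neumann extension and $T_F=Q_T^*Q_T^{**}$ is the Friedrichs extension of $T$. That is, a positive self-adjoint operator $S$ in $\mathcal H$ is an extension of $T$ if and only if $T_N\preceq S\preceq T_F$.
   Context: A linear operator $T:\mathcal H\to\mathcal H$ is a linear map from a linear subspace $\operatorname{dom}T\subseteq\mathcal H$ into $\mathcal H$. It is symmetric if $\langle Tf,g\rangle=\langle f,Tg\rangle$ for all $f,g\in\operatorname{dom}T$, positive if symmetric with $\langle Tf,f\rangle\ge0$ for $f\in\operatorname{dom}T$, and self-adjoint if densely defined with $T^*=T$. For a densely defined positive symmetric $T$, $\langle Tf,Th\rangle_{\mathcal E}:=\langle Tf,h\rangle$ ($f,h\in\operatorname{dom}T$) is a well-defined inner product on $\operatorname{ran}T$; the energy space $\mathcal E_T$ is the completion of $\operatorname{ran}T$ with respect to it. $J_T:\mathcal E_T\to\mathcal H$ is the (densely defined, closable) operator with $\operatorname{dom}J_T=\operatorname{ran}T$, $J_T(Th):=Th$. $Q_T:\mathcal H\to\mathcal E_T$ is the (densely defined, closable) operator with $\operatorname{dom}Q_T=\operatorname{dom}T$, $Q_Tf:=Tf\in\mathcal E_T$ (the restriction of $J_T^*$ to $\operatorname{dom}T$). Stars denote adjoints and double stars closures. Form order on positive self-adjoint operators: $S_1\preceq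 S_2$ iff $(I+S_2)^{-1}\le(I+S_1)^{-1}$; equivalently, $\operatorname{dom}S_2^{1/2}\subseteq\operatorname{dom}S_1^{1/2}$ and $\|S_1^{1/2}g\|^2\le\|S_2^{1/2}g\|^2$ for all $g\in\operatorname{dom}S_2^{1/2}$. *)

(* Defs.v *)
From HB Require Import structures.
From mathcomp Require Import all_boot all_order all_algebra.
From mathcomp Require Import complex.
From mathcomp Require Import boolp classical_sets reals topology normedtype.
Import Order.TTheory GRing.Theory Num.Theory.
Import numFieldNormedType.Exports.

Set Implicit Arguments.
Unset Strict Implicit.
Unset Printing Implicit Defensive.

Local Open Scope classical_set_scope.
Local Open Scope ring_scope.

(* Scalars and their conjugation: the reals with the identity, or the complex
   numbers with complex conjugation. *)
Variant real_or_complex (R : realType) :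
    forall K : numFieldType, (K -> K) -> Prop :=
| RealScalars : @real_or_complex R R idfun
| ComplexScalars : @real_or_complex R R[i] (@conjc R).

(* The library's [{dot H for theta}] is linear in the first argument and
   theta-linear in the second one. *)
HB.mixin Record CompleteNormedModule_isHilbert
    (K : numFieldType) (theta : K -> K) H of CompleteNormedModule K H := {
  inner : {dot H for theta};
  norm_inner : forall x : H, `|x| ^+ 2 = inner x x
}.

#[short(type="hilbertType")]
HB.structure Definition Hilbert (K : numFieldType) (theta : K -> K) :=
  {H of CompleteNormedModule K H & CompleteNormedModule_isHilbert K theta H}.

Notation "''[' x , y ]" := (inner x y) : ring_scope.

Section Operators.
Context {K : numFieldType} {theta : K -> K}.
Implicit Types H U V W : hilbertType theta.

(* An operator is identified with its graph: [A (f, g)] reads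
   "f is in dom A and A f = g". In particular [A `<=` B] says that B extends A,
   and [A = B] includes the equality of the domains. *)
Definition dom U V (A : set (U * V)) : set U := A.`1.
Definition ran U V (A : set (U * V)) : set V := A.`2.

Definition linear_operator U V (A : set (U * V)) : Prop :=
  [/\ A (0, 0),
      forall (a : K) f1 g1 f2 g2, A (f1, g1) -> A (f2, g2) ->
        A (a *: f1 + f2, a *: g1 + g2)
    & forall f g1 g2, A (f, g1) -> A (f, g2) -> g1 = g2].

Definition densely_defined U V (A : set (U * V)) : Prop := dense (dom A).

Definition adjoint U V (A : set (U * V)) : set (V * U) :=
  [set p | forall f g, A (f, g) -> '[g, p.1] = '[f, p.2]].

Definition compose U V W (A : set (V * W)) (B : set (U * V)) :
  set (U * W) := [set p | exists2 g, B (p.1, g) & A (g, p.2)].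

Definition inverse U V (A : set (U * V)) : set (V * U) :=
  [set p | A (p.2, p.1)].

Definition add_identity H (A : set (H * H)) : set (H * H) :=
  [set (p.1, p.1 + p.2) | p in A].

Definition symmetric_operator H (T : set (H * H)) : Prop :=
  linear_operator T /\
  forall f Tf g Tg, T (f, Tf) -> T (g, Tg) -> '[Tf, g] = '[f, Tg].

Definition positive_operator H (T : set (H * H)) : Prop :=
  symmetric_operator T /\ forall f Tf, T (f, Tf) -> 0 <= '[Tf, f].

Definition selfadjoint H (S : set (H * H)) : Prop :=
  [/\ linear_operator S, densely_defined S & adjoint S = S].

Definition positive_selfadjoint H (S : set (H * H)) : Prop :=
  positive_operator S /\ selfadjoint S.

Definition positive_selfadjoint_extension H (T S : set (H * H)) : Prop :=
  positive_selfadjoint S /\ T `<=` S.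

(* The usual order A <= B of bounded self-adjoint operators; for complex
   scalars, x <= y in R[i] means that y - x is real and nonnegative. *)
Definition operator_le H (A B : set (H * H)) : Prop :=
  [/\ dom A = setT, dom B = setT
    & forall f Af Bf, A (f, Af) -> B (f, Bf) -> '[Af, f] <= '[Bf, f]].

Definition resolvent H (S : set (H * H)) : set (H * H) :=
  inverse (add_identity S).

(* S1 is below S2 iff (I + S2)^-1 <= (I + S1)^-1. *)
Definition form_le H (S1 S2 : set (H * H)) : Prop :=
  [/\ positive_selfadjoint S1, positive_selfadjoint S2
    & operator_le (resolvent S2) (resolvent S1)].

Definition operator_interval H (A B : set (H * H)) : set (set (H * H)) :=
  [set S | [/\ selfadjoint S, form_le A S & form_le S B]].

Section EnergySpace.
Variables (H E : hilbertType theta) (T : set (H * H)) (iota : H -> E).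

(* [iota] exhibits the Hilbert space [E] as a completion of [ran T] equipped
   with <Tf, Th>_E := <Tf, h>; its values outside [ran T] are irrelevant. *)
Definition energy_space : Prop :=
  [/\ forall (a : K) x y, ran T x -> ran T y ->
        iota (a *: x + y) = a *: iota x + iota y,
      forall f Tf h Th, T (f, Tf) -> T (h, Th) ->
        '[iota Tf, iota Th] = '[Tf, h]
    & dense (iota @` ran T)].

Definition J_op : set (E * H) := [set (iota x, x) | x in ran T].

Definition Q_op : set (H * E) := [set (p.1, iota p.2) | p in T].

Definition krein_von_neumann : set (H * H) :=
  compose (adjoint (adjoint J_op)) (adjoint J_op).

Definition friedrichs : set (H * H) :=
  compose (adjoint Q_op) (adjoint (adjoint Q_op)).

End EnergySpace.
End Operators.

(* Main.v *)
(**
  No square roots are needed. For [S] positive self-adjoint and [h] a vector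
  write [h = f_S + S f_S]; then [S1] is below [S2] iff [<f_S2, h> <= <f_S1, h>]
  for all [h].  Both [TN] and [TF] have the form [B* B] with [B] closed, and the
  projection theorem in the graph of [B] gives [h = f + B* B f], which makes
  [B* B] positive self-adjoint.
  If [S] extends [T], then for [g] in [dom T] expanding
  [<(I + S)(f_S - g), f_S - g> >= 0] yields
  [<f_F, h> <= <f_S, h> + |g - f_F|^2 + |Q g - Q** f_F|^2], and the last two terms
  can be made arbitrarily small; expanding [<S a, a> + <S a, S a> >= 0] with
  [a = f_S - g] gives in the same way [<h - f_N, h> <= <h - f_S, h>].
  Conversely, if [TN <= S <= TF] and [h = g + T g], then [f_N = f_F = g], so
  [<f_S, h> = <f_F, h>] by squeezing; two comparable resolvents whose quadratic
  forms agree at [h] agree at [h], so [f_S = g] and [S g = T g].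
*)
Require Import Defs.
From mathcomp Require Import all_boot all_order all_algebra.
From mathcomp Require Import complex ring.
From mathcomp Require Import boolp classical_sets filter reals topology normedtype.
Import Order.TTheory GRing.Theory Num.Theory.
Import numFieldNormedType.Exports.

Set Implicit Arguments.
Unset Strict Implicit.
Unset Printing Implicit Defensive.

Local Open Scope classical_set_scope.
Local Open Scope ring_scope.

(** * Conjugation and infima of nonnegative scalars *)

Section Scalars.
Context {R : realType} {K : numFieldType} {theta : K -> K}.
Hypothesis scalars : real_or_complex R theta.

Lemma thetaD x y : theta (x + y) = theta x + theta y.
Proof. by case: scalars x y => // x y; rewrite rmorphD. Qed.

Lemma thetaM x y : theta (x * y) = theta x * theta y.
Proof. by case: scalars x y => // x y; rewrite rmorphM. Qed.

Lemma theta_ge0 x : 0 <= x -> theta x = x.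
Proof. by case: scalars x => // -[a b]; rewrite lecE /= => /andP[/eqP-> _]; rewrite oppr0. Qed.

Lemma mul_theta x : x * theta x = `|x| ^+ 2.
Proof.
case: scalars x => [x|x]; first by rewrite /= -expr2 real_normK // num_real.
by rewrite sqr_normc.
Qed.

(** The order on [R[i]] is only partial, but its nonnegative elements are real, so the infimum can
    be taken in [R] and carried back. *)
Lemma inf_exists (A : set K) : A !=set0 -> (forall a, A a -> 0 <= a) ->
  exists m, (forall a, A a -> m <= a) /\
    forall e, 0 < e -> exists2 a, A a & a < m + e.
Proof.
case: scalars A => A [a0 Aa0] A_ge0.
  have hiA : has_inf A by split; [exists a0 | exists 0].
  exists (inf A); split=> [a Aa|e e0]; last exact: inf_adherent.
  exact: (ge_inf (proj2 hiA)).
have AE a : A a -> exists2 r : R, a = r%:C%C & 0 <= r.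
  case: a => x y /A_ge0; rewrite lecE /= => /andP[/eqP-> x0].
  by exists x.
pose B := [set r : R | A r%:C%C].
have hiB : has_inf B.
  split; last by exists 0 => r /A_ge0; rewrite ler0c.
  by have [r a0E _] := AE _ Aa0; exists r; rewrite /B /= -a0E.
exists (inf B)%:C%C; split=> [a Aa|e e0].
  have [r aE _] := AE _ Aa; rewrite aE lecR.
  by apply: (ge_inf (proj2 hiB)); rewrite /B /= -aE.
case: e e0 => x y; rewrite ltcE /= => /andP[/eqP-> x0].
have [r Br lr] := inf_adherent x0 hiB.
by exists r%:C%C; rewrite // -rmorphD /= ltcR.
Qed.

End Scalars.

(** * Inner products and the Cauchy-Schwarz inequality *)

Section InnerProduct.
Context {R : realType} {K : numFieldType} {theta : K -> K}.
Hypothesis scalars : real_or_complex R theta.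
Implicit Types U V : hilbertType theta.

Lemma innerC U (x y : U) : '[x, y] = theta '[y, x].
Proof. by rewrite (hermitian_subproof (s := inner)) expr0 mul1r. Qed.

Lemma inner0l U (y : U) : '[0, y] = 0.
Proof. exact: linear0l. Qed.

Lemma inner0r U (x : U) : '[x, 0] = 0.
Proof. exact: linear0r. Qed.

Lemma innerDl U (x y z : U) : '[x + y, z] = '[x, z] + '[y, z].
Proof. exact: linearDl. Qed.

Lemma innerDr U (x y z : U) : '[x, y + z] = '[x, y] + '[x, z].
Proof. exact: linearDr. Qed.

Lemma innerNl U (x y : U) : '[- x, y] = - '[x, y].
Proof. exact: linearNl. Qed.

Lemma innerBl U (x y z : U) : '[x - y, z] = '[x, z] - '[y, z].
Proof. exact: linearBl. Qed.

Lemma innerBr U (x y z : U) : '[x, y - z] = '[x, y] - '[x, z].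
Proof. exact: linearBr. Qed.

Lemma innerZl U a (x y : U) : '[a *: x, y] = a * '[x, y].
Proof. exact: linearZl_LR. Qed.

Lemma innerZr U a (x y : U) : '[x, a *: y] = theta a * '[x, y].
Proof. exact: linearZr_LR. Qed.

Lemma innerNr U (x y : U) : '[x, - y] = - '[x, y].
Proof. exact: linearNr. Qed.

Definition innerE :=
  (@innerDl, @innerDr, @innerNl, @innerNr, @innerZl, @innerZr).

Lemma inner_eq0 U (x : U) : ('[x, x] == 0) = (x == 0).
Proof. by rewrite -norm_inner expf_eq0 /= normr_eq0. Qed.

Lemma inner_ge0 U (x : U) : 0 <= '[x, x].
Proof. by rewrite -norm_inner exprn_ge0. Qed.

Lemma inner_eqC U V (x y : U) (z w : V) : '[x, y] = '[z, w] -> '[y, x] = '[w, z].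
Proof. by move=> h; rewrite innerC h -innerC. Qed.

Lemma cauchy_schwarz U (x y : U) : `|'[x, y]| <= `|x| * `|y|.
Proof.
have [->|y0] := eqVneq y 0; first by rewrite inner0r !normr0 mulr0.
rewrite -(@ler_pXn2r _ 2) ?nnegrE ?mulr_ge0// exprMn !norm_inner.
have yy0 : 0 < '[y, y] by rewrite lt_def inner_eq0 y0 inner_ge0.
rewrite -(ler_pM2l yy0) -(mul_theta scalars) -innerC.
(* The squared norm of this vector is [<y,y> (<x,x> <y,y> - |<x,y>|^2)]. *)
have := inner_ge0 ('[y, y] *: x - '[x, y] *: y).
rewrite !innerE -(innerC y x) (theta_ge0 scalars (ltW yy0)) => h.
rewrite -subr_ge0; apply: le_trans h _; rewrite le_eqVlt; apply/orP; left.
by apply/eqP; ring.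
Qed.

(* Evaluate the hypothesis at [a = c / (N + 1)]. *)
Lemma quadratic_bound (c q N d : K) : 0 <= N ->
  (forall a, q - d <= q - theta a * c - a * theta c + a * theta a * N) ->
  `|c| ^+ 2 <= d * (N + 1).
Proof.
move=> N0 min; have N1 : 0 < N + 1 by rewrite ltr_wpDl.
have iN : 0 <= (N + 1)^-1 by rewrite invr_ge0 ltW.
have := min ((N + 1)^-1 * c).
rewrite (thetaM scalars) (theta_ge0 scalars iN) -(mul_theta scalars).
set x := c * theta c; have x0 : 0 <= x by rewrite /x (mul_theta scalars) exprn_ge0.
have -> : q - (N + 1)^-1 * theta c * c - (N + 1)^-1 * c * theta c
   + (N + 1)^-1 * c * ((N + 1)^-1 * theta c) * N
   = q - x * (N + 1)^-1 - x * (N + 1)^-1 ^+ 2.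
  by rewrite /x; field; rewrite gt_eqF.
rewrite -!addrA lerD2l lerNl opprD !opprK => h.
rewrite -ler_pdivrMr//; apply: le_trans h.
by rewrite lerDl mulr_ge0 // exprn_ge0.
Qed.

End InnerProduct.

(** * Closures and Cauchy filters in a product *)

Section Closure.
Context {K : numFieldType} {U V : completeNormedModType K}.

Lemma closure_pairP (M : set (U * V)) (p : U * V) : closure M p <->
  forall e : K, 0 < e -> exists q, [/\ M q, `|p.1 - q.1| < e & `|p.2 - q.2| < e].
Proof.
split=> [Mp e e0|Mp B].
  have [q [Mq [/= q1 q2]]] : M `&` ball p e !=set0 by apply: Mp; exact: nbhsx_ballx.
  by move: q1 q2; rewrite -!ball_normE; exists q.
rewrite -nbhs_ballE => -[e /= e0 eB].
have [q [Mq q1 q2]] := Mp e e0; exists q; split=> //; apply: eB.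
by split; rewrite -ball_normE.
Qed.

(** Both coordinate filters converge by completeness, and sets of [F] close to the pair of limits
    meet [M]. *)
Lemma cauchy_closure (M : set (U * V)) (F : set_system (U * V)) :
  ProperFilter F -> F M ->
  (forall e : K, 0 < e -> exists2 A, F A &
     forall p q, A p -> A q -> `|p.1 - q.1| < e /\ `|p.2 - q.2| < e) ->
  exists2 l, closure M l &
    forall e : K, 0 < e -> F [set q | `|l.1 - q.1| < e /\ `|l.2 - q.2| < e].
Proof.
move=> PF FM cF.
have c1 : cauchy (fst @ F).
  apply/cauchyP => e e0; have [A FA Ae] := cF e e0.
  have [p Ap] := filter_ex FA; exists p.1.
  by apply: (@filterS _ F _ A _ _ FA) => q Aq; rewrite -ball_normE /=; have [] := Ae p q Ap Aq.
have c2 : cauchy (snd @ F).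
  apply/cauchyP => e e0; have [A FA Ae] := cF e e0.
  have [p Ap] := filter_ex FA; exists p.2.
  by apply: (@filterS _ F _ A _ _ FA) => q Aq; rewrite -ball_normE /=; have [] := Ae p q Ap Aq.
have /cvgrPdist_lt l1P : cvg (fst @ F) by exact: cauchy_cvg.
have /cvgrPdist_lt l2P : cvg (snd @ F) by exact: cauchy_cvg.
set l1 := lim _ in l1P; set l2 := lim _ in l2P.
have lP e : 0 < e -> F [set q | `|l1 - q.1| < e /\ `|l2 - q.2| < e].
  by move=> e0; exact: filterI (l1P _ e0) (l2P _ e0).
exists (l1, l2) => //; apply/closure_pairP => e e0 /=.
have [q [[q1 q2] Mq]] := filter_ex (filterI (lP e e0) FM).
by exists q.
Qed.

End Closure.

(** * Orthogonal projection in a product *)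

Section Projection.
Context {R : realType} {K : numFieldType} {theta : K -> K}.
Hypothesis scalars : real_or_complex R theta.
Context {U V : hilbertType theta}.

(** A linear relation, possibly multivalued, so that adjoints and inverses of linear graphs are
    covered. *)
Definition linear_subset (M : set (U * V)) : Prop :=
  M (0, 0) /\ forall (a : K) f1 g1 f2 g2, M (f1, g1) -> M (f2, g2) ->
        M (a *: f1 + f2, a *: g1 + g2).

(** For nonzero [x], the choice [e = |x| / (N + 1)] would give [N + 1 <= N]. *)
Lemma arbitrarily_small_eq0 (W : normedZmodType K) (x : W) (N : K) : 0 <= N ->
  (forall e, 0 < e -> `|x| <= e * N) -> x = 0.
Proof.
move=> N0 small; apply/eqP/negPn/negP => x0.
have N1 : 0 < N + 1 by rewrite ltr_wpDl.
have := small (`|x| / (N + 1)); rewrite divr_gt0 ?normr_gt0// => /(_ isT).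
rewrite mulrAC ler_pdivlMr// ler_pM2l ?normr_gt0//.
by rewrite -subr_ge0 opprD addrA subrr add0r oppr_ge0 real_leNgt ?ltr01 ?real1.
Qed.

Lemma parallelogram (W : hilbertType theta) (h x y : W) :
  '[x - y, x - y] + 4 * '[h - 2^-1 *: (x + y), h - 2^-1 *: (x + y)] =
  2 * '[h - x, h - x] + 2 * '[h - y, h - y].
Proof.
by rewrite !innerE (theta_ge0 scalars) ?invr_ge0//; field.
Qed.

Lemma norm_lt_inner (W : hilbertType theta) (x : W) e :
  0 < e -> '[x, x] < e ^+ 2 -> `|x| < e.
Proof. by move=> e0; rewrite -norm_inner ltr_pXn2r ?nnegrE// ltW. Qed.

(** The squared distance [Q] of the Hilbert direct sum is minimised over [M], with a filter of
    near-minimisers in place of a minimising sequence. *)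
Lemma projection (M : set (U * V)) (h : U) (k : V) : linear_subset M ->
  exists f g, closure M (f, g) /\
    forall x y, M (x, y) -> '[h - f, x] + '[k - g, y] = 0.
Proof.
move=> [M0 ML].
pose Q (p : U * V) := '[h - p.1, h - p.1] + '[k - p.2, k - p.2].
have [||m [mQ mA]] := inf_exists scalars (A := Q @` M).
- by exists (Q (0, 0)), (0, 0).
- by move=> _ [p _ <-]; rewrite addr_ge0 ?inner_ge0.
pose near_min (d : K) := [set p | M p /\ Q p < m + d].
pose F := filter_from [set d : K | 0 < d] near_min.
have FF : ProperFilter F.
  apply: filter_from_proper; last first.
    by move=> d /= d0; have [_ [p Mp <-] Qp] := mA d d0; exists p.
  apply: filter_from_filter; first by exists 1; exact: ltr01.
  move=> d e /= d0 e0.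
  (* [K] need not be totally ordered, but positive scalars are real and hence comparable. *)
  have [de|ed] := real_leP (gtr0_real d0) (gtr0_real e0).
    exists d => // p [Mp Qp]; split; split=> //.
    by apply: lt_le_trans Qp _; rewrite lerD2l.
  exists e => // p [Mp Qp]; split; split=> //.
  by apply: lt_trans Qp _; rewrite ltrD2l.
have near_minF d : 0 < d -> F (near_min d) by move=> d0; exists d.
have [|//|l lM lF] := @cauchy_closure _ _ _ M F.
- by apply: filterS (near_minF 1 ltr01) => p [].
(* With slack [e^2 / 4] at both points and [Q >= m] at their midpoint, the parallelogram law bounds
   the squared distance by [4 (m + e^2 / 4) - 4 m = e^2]. *)
- move=> e e0; exists (near_min (e ^+ 2 / 4)).
    by apply: near_minF; rewrite divr_gt0// exprn_gt0.
  move=> [p1 p2] [q1 q2] [/= Mp Qp] [Mq Qq].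
  have Mmid : M (2^-1 *: (p1 + q1), 2^-1 *: (p2 + q2)).
    rewrite !scalerDr; apply: (ML _ _ _ _ _ Mp).
    by have := ML 2^-1 _ _ _ _ Mq M0; rewrite !addr0.
  have D : '[p1 - q1, p1 - q1] + '[p2 - q2, p2 - q2] < e ^+ 2.
    set D := _ + _.
    have DE : D + 4 * Q (2^-1 *: (p1 + q1), 2^-1 *: (p2 + q2)) =
        2 * Q (p1, p2) + 2 * Q (q1, q2).
      by rewrite /Q /D /= mulrDr addrACA !parallelogram; ring.
    rewrite -(ltrD2r (4 * Q (2^-1 *: (p1 + q1), 2^-1 *: (p2 + q2)))) DE.
    have QQ : 2 * Q (p1, p2) + 2 * Q (q1, q2) < e ^+ 2 + 4 * m.
      rewrite [ltRHS](_ : _ = 2 * (m + e ^+ 2 / 4) + 2 * (m + e ^+ 2 / 4)); last by field.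
      by rewrite ltrD// ltr_pM2l.
    apply: lt_le_trans QQ _; rewrite lerD2l ler_pM2l//.
    by apply: mQ; exists (2^-1 *: (p1 + q1), 2^-1 *: (p2 + q2)).
  by split; apply: norm_lt_inner => //; apply: le_lt_trans D; rewrite ?lerDl ?lerDr inner_ge0.
exists l.1, l.2; split; first by rewrite -surjective_pairing.
move=> x y Mxy; pose N := '[x, x] + '[y, y] + 1.
have N0 : 0 < N by rewrite ltr_wpDl// addr_ge0 ?inner_ge0.
apply: (arbitrarily_small_eq0 (N := `|x| + `|y| + N)).
  by apply: addr_ge0; [exact: addr_ge0 | exact: ltW].
move=> e e0.
have [[p1 p2] /= [[lp1 lp2] [Mp Qp]]] :=
  filter_ex (filterI (lF e e0) (near_minF (e ^+ 2) (exprn_gt0 2 e0))).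
(* Moving from [p] along [(x, y)] lowers [Q] by at most [e^2], which bounds the first-order term. *)
have cN : `|'[h - p1, x] + '[k - p2, y]| ^+ 2 <= e ^+ 2 * N.
  apply: (quadratic_bound scalars (q := Q (p1, p2))).
    by rewrite addr_ge0 ?inner_ge0.
  move=> a.
  apply: (@le_trans _ _ m); first by rewrite lerBlDr ltW.
  have := mQ _ (ex_intro2 _ _ _ (ML a _ _ _ _ Mxy Mp) erefl).
  congr (_ <= _); rewrite (thetaD scalars) -!innerC /Q /= !innerE; ring.
have c_le : `|'[h - p1, x] + '[k - p2, y]| <= e * N.
  rewrite -(@ler_pXn2r _ 2) ?nnegrE ?(mulr_ge0 (ltW e0) (ltW N0))//.
  apply: le_trans cN _; rewrite exprMn ler_pM2l ?exprn_gt0// expr2 ler_peMl ?(ltW N0)//.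
  by rewrite lerDr addr_ge0 ?inner_ge0.
have -> : '[h - l.1, x] + '[k - l.2, y] =
    '[h - p1, x] + '[k - p2, y] - ('[l.1 - p1, x] + '[l.2 - p2, y]).
  by rewrite !innerE; ring.
apply: le_trans (ler_normB _ _) _; rewrite mulrDr addrC lerD//.
apply: le_trans (ler_normD _ _) _; rewrite mulrDr lerD//;
  by apply: le_trans (cauchy_schwarz scalars _ _) _; rewrite ler_wpM2r// ltW.
Qed.

End Projection.

(** * Adjoints of linear relations *)

Section Graphs.
Context {R : realType} {K : numFieldType} {theta : K -> K}.
Hypothesis scalars : real_or_complex R theta.
Implicit Types U V : hilbertType theta.

Lemma adjoint_linear U V (A : set (U * V)) : linear_subset (adjoint A).
Proof.
split=> [f g _|a f1 g1 f2 g2 A1 A2 f g Afg] /=; first by rewrite !inner0r.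
by have := A1 f g Afg; have := A2 f g Afg; rewrite /= !innerE => -> ->.
Qed.

Lemma sub_biadjoint U V (A : set (U * V)) : A `<=` adjoint (adjoint A).
Proof. by move=> [f g] Afg x y /(_ f g Afg) /= /inner_eqC. Qed.

Lemma adjointS U V (A B : set (U * V)) : A `<=` B -> adjoint B `<=` adjoint A.
Proof. by move=> AB p Bp f g /AB; exact: Bp. Qed.

Lemma adjoint_inverse U V (A : set (U * V)) :
  adjoint (inverse A) = inverse (adjoint A).
Proof.
by apply/seteqP; split=> -[x y] Axy f g Afg; symmetry; exact: Axy.
Qed.

Lemma triadjoint U V (A : set (U * V)) : adjoint (adjoint (adjoint A)) = adjoint A.
Proof.
by apply/seteqP; split; [exact: adjointS (@sub_biadjoint _ _ A) | exact: sub_biadjoint].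
Qed.

Lemma closure_adjoint U V (A : set (U * V)) : closure (adjoint A) `<=` adjoint A.
Proof.
move=> [x y] /closure_pairP cl f g Afg /=; apply/eqP; rewrite -subr_eq0; apply/eqP.
apply: (arbitrarily_small_eq0 (N := `|g| + `|f|)) => [|e e0]; first exact: addr_ge0.
have [[x' y'] [Axy /= xe ye]] := cl e e0.
have -> : '[g, x] - '[f, y] = '[g, x - x'] - '[f, y - y'].
  by have /= := Axy f g Afg; rewrite !innerE => ->; ring.
apply: le_trans (ler_normB _ _) _; rewrite mulrDr lerD//;
  apply: le_trans (cauchy_schwarz scalars _ _) _;
  by rewrite mulrC ler_wpM2r// ltW.
Qed.

(* The residual of the projection onto the graph is orthogonal to the graph,
   and rotating it by a quarter turn puts it in the graph of the adjoint. *)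
Lemma biadjoint_sub_closure U V (A : set (U * V)) :
  linear_subset A -> adjoint (adjoint A) `<=` closure A.
Proof.
move=> Alin [h k] Ahk.
have [f [g [Afg orth]]] := projection scalars h k Alin.
have Arot : adjoint A (k - g, f - h).
  move=> x y /orth xy; apply: inner_eqC; apply/eqP.
  by rewrite -[f - h]opprB innerNl -addr_eq0 addrC xy.
have Afg2 : adjoint (adjoint A) (f, g).
  by apply: closure_adjoint; exact: closure_subset (@sub_biadjoint _ _ A) _ Afg.
have : '[k - g, k - g] + '[h - f, h - f] = 0.
  rewrite innerBr -(Ahk _ _ Arot) -(Afg2 _ _ Arot) /= -innerBr.
  by rewrite -[f - h]opprB innerNl addNr.
move/eqP; rewrite paddr_eq0 ?inner_ge0// !inner_eq0 !subr_eq0.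
by move=> /andP[/eqP-> /eqP->].
Qed.

(** Projecting [(h, 0)] onto [adjoint A] leaves the residual [(h - f, -b)]; its orthogonality to
    that graph says that [(b, h - f)] lies in the double adjoint. *)
Lemma decomposition U V (A : set (U * V)) (h : V) :
  exists f b, adjoint A (f, b) /\ adjoint (adjoint A) (b, h - f).
Proof.
have [f [b [cl orth]]] := projection scalars h 0 (adjoint_linear A).
exists f, b; split; first exact: closure_adjoint cl.
move=> x y /orth /eqP; rewrite sub0r innerNl subr_eq0 => /eqP.
by move/inner_eqC.
Qed.
End Graphs.

(** * Von Neumann's theorem on [B* B] *)

Section PositiveSelfadjoint.
Context {R : realType} {K : numFieldType} {theta : K -> K}.
Hypothesis scalars : real_or_complex R theta.
Implicit Types U V : hilbertType theta.

Lemma dense_orthogonal U (D : set U) (y : U) :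
  dense D -> (forall x, D x -> '[x, y] = 0) -> y = 0.
Proof.
move=> Dd orth; apply/eqP; rewrite -inner_eq0; apply/eqP.
apply: (arbitrarily_small_eq0 (N := `|y|)) => // e e0.
have [x [/= xe Dx]] : ball y e `&` D !=set0.
  by apply: Dd; [exists y; exact: ballxx | exact: ball_open].
rewrite -[X in '[X, _]](subrK x) innerDl (orth x Dx) addr0.
apply: le_trans (cauchy_schwarz scalars _ _) _.
by rewrite ler_wpM2r// ltW//; move: xe; rewrite -ball_normE.
Qed.

Lemma orthogonal_dense U (D : set U) :
  D 0 -> (forall (a : K) x y, D x -> D y -> D (a *: x + y)) ->
  (forall y, (forall x, D x -> '[y, x] = 0) -> y = 0) -> dense D.
Proof.
move=> D0 DL orth O [h Oh] Oo.
(* Embedding [D] as [D x {0}] makes [projection] available; the residual of [h] is orthogonal to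
   [D], hence zero. *)
pose M : set (U * U) := [set p | D p.1 /\ p.2 = 0].
have Mlin : linear_subset M.
  by split=> // a f1 g1 f2 g2 [D1 /= ->] [D2 /= ->]; split;
    rewrite ?scaler0 ?addr0//; exact: DL.
have [f [g [cl fg]]] := projection scalars h 0 Mlin.
have hf : h = f.
  apply/eqP; rewrite -subr_eq0; apply/eqP/orth => x Dx.
  by have := fg x 0 (conj Dx erefl); rewrite inner0r addr0.
have : nbhs h O by exact: open_nbhs_nbhs.
rewrite -nbhs_ballE => -[e /= e0 eO].
have [[x z] [[/= Dx _] xe _]] := (closure_pairP M (f, g)).1 cl e e0.
by exists x; split=> //; apply: eO; rewrite -ball_normE /= hf.
Qed.

(** Surjectivity of [I + S] leaves no room for a nonzero vector orthogonal to the domain, nor for an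
    adjoint larger than [S]. *)
Lemma positive_selfadjoint_of_surj U (S : set (U * U)) : linear_operator S ->
  (forall f Sf g Sg, S (f, Sf) -> S (g, Sg) -> '[Sf, g] = '[f, Sg]) ->
  (forall f Sf, S (f, Sf) -> 0 <= '[Sf, f]) ->
  (forall h, exists f, S (f, h - f)) -> positive_selfadjoint S.
Proof.
move=> Slin Ssym Spos Ssurj; split; first by split.
have [S0 SL Sfun] := Slin; split=> //.
  apply: orthogonal_dense; first by exists 0.
    by move=> a x y [x' Sx] [y' Sy]; exists (a *: x' + y'); exact: SL.
  (* For [h = f + S f] orthogonal to the domain, [0 <= <S f, f> = -<f, f>] forces [f = 0], hence
     [h = S 0 = 0]. *)
  move=> h orth; have [f Sf] := Ssurj h.
  have f0 : f = 0.
    have := Spos _ _ Sf; rewrite innerBl orth; last by exists (h - f).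
    rewrite sub0r oppr_ge0 => ff; apply/eqP; rewrite -inner_eq0.
    by rewrite eq_le ff inner_ge0.
  by move: Sf; rewrite f0 subr0 => S0h; exact: Sfun S0h S0.
apply/seteqP; split=> [[g g'] Sg | [g Sg] Sgg f Sf Sff]; last exact: Ssym.
(* Here [(I + S) f = g + g']; testing the adjoint relation at [u] with [(I + S) u = g - f] gives
   [g = f]. *)
have [f Sf] := Ssurj (g + g').
suff gf : g - f = 0.
  move/eqP: gf; rewrite subr_eq0 => /eqP gf; move: Sf.
  by rewrite -gf [g + g']addrC addrK.
have [u Su] := Ssurj (g - f).
apply/eqP; rewrite -inner_eq0; apply/eqP.
have E1 : '[g - f, g] = '[u, g + g'].
  have := Sg _ _ Su => /= /eqP.
  by rewrite (innerBl _ u) subr_eq => /eqP->; rewrite innerDr addrC.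
have E2 : '[g - f, f] = '[u, g + g'].
  have := Ssym _ _ _ _ Su Sf => /eqP.
  by rewrite (innerBl _ u) subr_eq => /eqP->; rewrite -innerDr subrK.
by rewrite innerBr E1 E2 subrr.
Qed.

Lemma von_neumann U V (A : set (V * U)) : densely_defined (adjoint A) ->
  positive_selfadjoint (compose (adjoint (adjoint A)) (adjoint A)).
Proof.
set B := adjoint A => Bd; apply: positive_selfadjoint_of_surj.
- split.
  + by exists 0; [exact: (adjoint_linear A).1 | exact: (adjoint_linear B).1].
  + move=> a f1 g1 f2 g2 [b1 B1 C1] [b2 B2 C2]; exists (a *: b1 + b2).
      exact: (adjoint_linear A).2.
    exact: (adjoint_linear B).2.
  + move=> f g1 g2 [b1 B1 C1] [b2 B2 C2].
    (* [B] may be multivalued, but [b1 - b2] lies both in [B 0] and in the domain of [B*], so it is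
       orthogonal to itself. *)
    have b12 : b1 = b2.
      apply/eqP; rewrite -subr_eq0 -inner_eq0; apply/eqP.
      have B0 : B (0, b1 - b2).
        have := (adjoint_linear A).2 (-1) _ _ _ _ B2 B1.
        by rewrite !scaleN1r addNr addrC.
      have Cb : adjoint B (b1 - b2, g1 - g2).
        have := (adjoint_linear B).2 (-1) _ _ _ _ C2 C1.
        by rewrite !scaleN1r ![- _ + _]addrC.
      by have := Cb _ _ B0; rewrite /= inner0l.
    rewrite b12 in C1.
    apply/eqP; rewrite -subr_eq0; apply/eqP.
    apply: dense_orthogonal Bd _ => x [y Bxy].
    by have := C1 _ _ Bxy; have := C2 _ _ Bxy; rewrite /= innerBr => -> ->; rewrite subrr.
- move=> f y g z [b Bf Cb] [c Bg Cc].
  by have := Cc _ _ Bf; have := Cb _ _ Bg => /= /inner_eqC -> ->.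
- by move=> f y [b Bf Cb]; have := Cb _ _ Bf => /= /inner_eqC<-; exact: inner_ge0.
- by move=> h; have [f [b [Bf Cb]]] := decomposition scalars A h; exists f, b.
Qed.

End PositiveSelfadjoint.

(** * Resolvents and the form order *)

Section Resolvent.
Context {R : realType} {K : numFieldType} {theta : K -> K}.
Hypothesis scalars : real_or_complex R theta.
Context {H : hilbertType theta}.
Implicit Types S : set (H * H).

(** The cross terms of [|f + S f|^2] are nonnegative. The bound turns Cauchy values of [I + S] into
    Cauchy arguments. *)
Lemma norm_le_add_identity S f Sf : positive_operator S -> S (f, Sf) ->
  `|f| <= `|f + Sf|.
Proof.
move=> [_ Spos] Sff; rewrite -(@ler_pXn2r _ 2) ?nnegrE// !norm_inner !innerE.
have Sff0 := Spos _ _ Sff.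
have fS : 0 <= '[f, Sf] by rewrite (innerC f Sf) (theta_ge0 scalars).
by rewrite -addrA lerDl !addr_ge0 ?inner_ge0.
Qed.

(** The range of [I + S] is dense, since a vector [v] orthogonal to it satisfies [S v = -v] and
    positivity gives [v = 0]; it is closed, since [I + S] is bounded below and [S] has a closed
    graph. *)
Lemma add_identity_surj S h : positive_selfadjoint S -> exists f, S (f, h - f).
Proof.
move=> [Spos [Slin _ Ssa]]; have [[_ Ssym] Sge0] := Spos.
have [S0 SL _] := Slin.
have SB f1 g1 f2 g2 : S (f1, g1) -> S (f2, g2) -> S (f1 - f2, g1 - g2).
  by move=> S1 S2; have := SL (-1) _ _ _ _ S2 S1; rewrite !scaleN1r ![- _ + _]addrC.
pose M : set (H * H) := [set p | ran (add_identity S) p.1 /\ p.2 = 0].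
have MP f Sf : S (f, Sf) -> M (f + Sf, 0).
  by move=> Sff; split=> //; exists f; exists (f, Sf).
have MI p : M p -> exists f Sf, S (f, Sf) /\ p = (f + Sf, 0).
  by case: p => a b [[/= f [[f1 g1] Sfg [/= _ <-]]] ->]; exists f1, g1.
have Mlin : linear_subset M.
  split=> [|a f1 g1 f2 g2].
    by have := MP _ _ S0; rewrite addr0.
  move=> /MI[x1 [y1 [S1 [-> ->]]]] /MI[x2 [y2 [S2 [-> ->]]]].
  have := MP _ _ (SL a _ _ _ _ S1 S2).
  by rewrite scaler0 addr0 scalerDr addrACA.
have [l [k [cl orth]]] := projection scalars h 0 Mlin.
have hl : h = l.
  have Sd : S (h - l, - (h - l)).
    rewrite -Ssa => f Sf Sff /=; have := orth _ _ (MP _ _ Sff).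
    rewrite inner0r addr0 innerDr addrC => /eqP.
    by rewrite addr_eq0 -innerNl => /eqP /inner_eqC.
  apply/eqP; rewrite -subr_eq0 -inner_eq0 eq_le inner_ge0 andbT.
  by rewrite -oppr_ge0 -innerNl Sge0.
have clh : forall e, 0 < e -> exists p, S p /\ `|h - (p.1 + p.2)| < e.
  move=> e e0; have [q [/MI[f [Sf [Sff ->]]] /= lt_e _]] := (closure_pairP _ _).1 cl e e0.
  by exists (f, Sf); rewrite hl.
pose A (e : K) := [set p | S p /\ `|h - (p.1 + p.2)| < e].
pose F := filter_from [set e : K | 0 < e] A.
have FF : ProperFilter F.
  apply: filter_from_proper; last by move=> e /clh.
  apply: filter_from_filter; first by exists 1; exact: ltr01.
  move=> d e /= d0 e0.
  have [de|ed] := real_leP (gtr0_real d0) (gtr0_real e0).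
    by exists d => // p [Sp lt_d]; split; split=> //; exact: lt_le_trans lt_d de.
  by exists e => // p [Sp lt_e]; split; split=> //; exact: lt_trans lt_e ed.
have FA e : 0 < e -> F (A e) by move=> e0; exists e.
have [|e e0|[f g] cfg fgF] := @cauchy_closure _ _ _ S F.
- by apply: filterS (FA 1 ltr01) => p [].
(* At two approximate solutions the values of [I + S] differ by less than [e / 2], hence so do the
   arguments, and by subtraction the values of [S] differ by less than [e]. *)
- exists (A (e / 4)); first by apply: FA; rewrite divr_gt0.
  move=> [p p'] [q q'] [Sp /= lep] [Sq /= leq].
  have pq := SB _ _ _ _ Sp Sq.
  have sum_le : `|p - q + (p' - q')| < e / 2.
    have -> : p - q + (p' - q') = h - (q + q') - (h - (p + p')).
      by symmetry; rewrite opprB addrC addrA subrK opprD addrACA.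
    apply: le_lt_trans (ler_normB _ _) _.
    by rewrite [ltRHS](_ : _ = e / 4 + e / 4); [rewrite ltrD | field].
  have diff_le := le_lt_trans (norm_le_add_identity Spos pq) sum_le.
  split; first by apply: lt_trans diff_le _; rewrite ltr_pdivrMr// mulr_natr mulr2n ltrDl.
  have -> : p' - q' = p - q + (p' - q') - (p - q) by rewrite [RHS]addrC addKr.
  by apply: le_lt_trans (ler_normB _ _) _; rewrite [e]splitr ltrD.
exists f.
have Sfg : S (f, g) by rewrite -Ssa; apply: (closure_adjoint scalars); rewrite Ssa.
suff -> : h - f = g by [].
apply/eqP; rewrite -subr_eq0; apply/eqP.
apply: (arbitrarily_small_eq0 (N := 3)) => // e e0.
have [[p p'] /= [[lp lp'] [Sp lep]]] := filter_ex (filterI (fgF e e0) (FA e e0)).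
have -> : h - f - g = h - (p + p') - (f - p) - (g - p').
  by symmetry; rewrite -addrA -opprD addrACA -opprD opprB addrA subrK opprD addrA.
rewrite [leRHS](_ : _ = e + e + e); last by ring.
apply: le_trans (ler_normB _ _) _; apply: lerD (ltW lp').
by apply: le_trans (ler_normB _ _) _; apply: lerD (ltW lep) (ltW lp).
Qed.

Lemma resolventP S h f : resolvent S (h, f) <-> S (f, h - f).
Proof.
split=> [[[x y] Sxy [/= <- <-]]|Sf]; first by rewrite addrC addKr.
by exists (f, h - f); rewrite //= addrC subrK.
Qed.

(** Both resolvents are everywhere defined by [add_identity_surj], so only the inequality of
    quadratic forms remains. *)
Lemma form_leP S1 S2 : positive_selfadjoint S1 -> positive_selfadjoint S2 ->
  form_le S1 S2 <->
  forall h f1 f2, S1 (f1, h - f1) -> S2 (f2, h - f2) -> '[f2, h] <= '[f1, h].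
Proof.
move=> S1p S2p; split=> [[_ _ [_ _ le12]] h f1 f2 Sf1 Sf2|le12].
  by apply: le12; exact/resolventP.
have domT S : positive_selfadjoint S -> dom (resolvent S) = setT.
  move=> Sp; apply/seteqP; split=> // h _.
  by have [f Sf] := add_identity_surj h Sp; exists f; exact/resolventP.
split=> //; split=> [||h f2 f1 /resolventP Sf2 /resolventP Sf1]; [exact: domT..|].
exact: le12 Sf1 Sf2.
Qed.

(* The difference [D] of the two resolvents is positive, so [<Dh, h> = 0]
   forces [Dh = 0]: otherwise [<D(h - a Dh), h - a Dh>] becomes negative. *)
Lemma form_le_resolvent_eq S1 S2 h f1 f2 : form_le S1 S2 ->
  S1 (f1, h - f1) -> S2 (f2, h - f2) -> '[f1, h] = '[f2, h] -> f1 = f2.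
Proof.
move=> le12; have [S1p S2p _] := le12.
move/(form_leP S1p S2p) : le12 => le12 Sf1 Sf2 eq_h.
have [w wE] : exists w, w = f1 - f2 by exists (f1 - f2).
have [w1 Sw1] := add_identity_surj w S1p; have [w2 Sw2] := add_identity_surj w S2p.
have sym S u v k l : positive_selfadjoint S -> S (u, k - u) -> S (v, l - v) ->
    '[k, v] = '[u, l].
  move=> [[[_ Ssym] _] _] Su Sv; have := Ssym _ _ _ _ Su Sv.
  by rewrite innerBl innerBr => /addIr.
have lin S (a : K) u v k l : positive_selfadjoint S -> S (u, k - u) -> S (v, l - v) ->
    S (a *: u + v, a *: k + l - (a *: u + v)).
  move=> [[[[_ SL _] _] _] _] Su Sv; have := SL a _ _ _ _ Su Sv.
  by rewrite scalerBr opprD addrACA.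
have N0 : 0 <= '[w1, w] - '[w2, w] by rewrite subr_ge0; exact: le12 Sw1 Sw2.
have /(quadratic_bound scalars N0 (c := '[w, w]) (q := 0) (d := 0)) :
    forall a, 0 - 0 <= 0 - theta a * '[w, w] - a * theta '[w, w] +
                       a * theta a * ('[w1, w] - '[w2, w]).
  move=> a; have := le12 _ _ _ (lin _ (- a) _ _ _ _ S1p Sw1 Sf1)
    (lin _ (- a) _ _ _ _ S2p Sw2 Sf2).
  rewrite -subr_ge0 subrr; congr (_ <= _).
  have ww : '[w1, h] = '[w, w] + '[w2, h].
    apply/eqP; rewrite -subr_eq; apply/eqP.
    by rewrite {2}wE innerBr (sym _ _ _ _ _ S1p Sw1 Sf1) (sym _ _ _ _ _ S2p Sw2 Sf2).
  have ww' : '[f1, w] = '[w, w] + '[f2, w] by rewrite {2}wE innerBl subrK.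
  by rewrite -innerC !scaleNr !innerE eq_h ww' ww; ring.
rewrite mul0r => c0; apply/eqP; rewrite -subr_eq0 -wE -inner_eq0 -normr_eq0.
have : `|'[w, w]| ^+ 2 == 0 by rewrite eq_le c0 exprn_ge0.
by rewrite expf_eq0.
Qed.

End Resolvent.

(** * Minimisation of the energy functional *)

Section Energy.
Context {R : realType} {K : numFieldType} {theta : K -> K}.
Hypothesis scalars : real_or_complex R theta.

(* For [(g, q)] in [B] the left-hand side of [ge0] equals
   [c - <f, h> + |g - f|^2 + |q - b|^2], and [(g, q)] can be taken arbitrarily
   close to [(f, b)]. *)
Lemma energy_minimum (U V : hilbertType theta) (B : set (U * V)) h f b c :
  linear_subset B -> adjoint (adjoint B) (f, b) -> adjoint B (b, h - f) ->
  (forall g q, B (g, q) -> 0 <= c - '[g, h] - '[h, g] + '[g, g] + '[q, q]) ->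
  '[f, h] <= c.
Proof.
move=> Blin Bfb Bbh ge0; apply/ler_addgt0Pr => e e0.
(* This gives [d <= 1] and [d <= e / 2], hence [d^2 <= e / 2] for each of the two error terms. *)
pose d := e / (e + 2).
have e2 : 0 < e + 2 by rewrite addr_gt0.
have d0 : 0 < d by rewrite divr_gt0.
have dd : d ^+ 2 <= e / 2.
  rewrite expr2; apply: (@le_trans _ _ d).
    by rewrite ler_piMl ?(ltW d0)// ler_pdivrMr// mul1r lerDl.
  by rewrite ler_pM2l// lef_pV2 ?posrE// lerDr ltW.
have [[g q] [Bgq /= gf qb]] :=
  (closure_pairP _ _).1 (biadjoint_sub_closure scalars Blin Bfb) d d0.
have fh : '[f, h] = '[f, f] + '[b, b].
  by have /= /inner_eqC <- := Bfb _ _ Bbh; rewrite innerBr addrC subrK.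
have lt_d (W : hilbertType theta) (x : W) : `|x| < d -> '[x, x] <= e / 2.
  move=> xd; rewrite -norm_inner; apply: le_trans dd.
  by rewrite ler_pXn2r ?nnegrE// ltW.
have := ge0 _ _ Bgq.
have -> : c - '[g, h] - '[h, g] + '[g, g] + '[q, q] =
    c + ('[f - g, f - g] + '[b - q, b - q]) - '[f, h].
  have /= gh := Bbh _ _ Bgq; have hg := inner_eqC gh.
  have -> : '[g, h] = '[q, b] + '[g, f] by rewrite gh innerBr subrK.
  have -> : '[h, g] = '[b, q] + '[f, g] by rewrite hg innerBl subrK.
  by rewrite fh !innerE; ring.
rewrite subr_ge0 => /le_trans; apply.
by rewrite lerD2l [e]splitr lerD// lt_d.
Qed.


(** * The two extremal extensions *)

Section Extensions.
Variables (H E : hilbertType theta) (T : set (H * H)) (iota : H -> E).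
Hypotheses (T_dense : densely_defined T) (T_pos : positive_operator T).
Hypothesis ET : energy_space T iota.

Let iota_linear (a : K) f Tf h Th : T (f, Tf) -> T (h, Th) ->
  iota (a *: Tf + Th) = a *: iota Tf + iota Th.
Proof. by case: ET => iL _ _ Tff Thh; apply: iL; [exists f | exists h]. Qed.

Let iota0 : iota 0 = 0.
Proof.
case: T_pos => -[[T0 _ _] _] _.
by have := iota_linear (-1) T0 T0; rewrite !scaleN1r !addNr.
Qed.

Let inner_iota f Tf h Th : T (f, Tf) -> T (h, Th) -> '[iota Tf, iota Th] = '[Tf, h].
Proof. by case: ET => _ + _; apply. Qed.

Lemma Q_op_linear : linear_subset (Q_op T iota).
Proof.
case: T_pos => -[[T0 TL _] _] _; split=> [|a f1 g1 f2 g2].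
  by exists (0, 0); rewrite //= iota0.
move=> [[x1 y1] T1 [/= <- <-]] [[x2 y2] T2 [/= <- <-]].
by exists (a *: x1 + x2, a *: y1 + y2); [exact: TL | rewrite /= (iota_linear _ T1 T2)].
Qed.

(** [J_op] is read backwards, as a relation from [H] to [E], so that [energy_minimum] can be applied
    to it. *)
Lemma inverse_J_op_linear : linear_subset (inverse (J_op T iota)).
Proof.
case: T_pos => -[[T0 TL _] _] _; split=> [|a f1 g1 f2 g2].
  by exists 0; [exists 0 | rewrite /= iota0].
move=> [y1 [x1 T1] [/= <- <-]] [y2 [x2 T2] [/= <- <-]].
exists (a *: y1 + y2); [exists (a *: x1 + x2); exact: TL|].
by rewrite /= (iota_linear _ T1 T2).
Qed.

(** [J*] sends [g] to [iota (T g)], since [<iota (T f), iota (T g)> = <T f, g>], and [J] sends that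
    back to [T g]. *)
Lemma sub_krein_von_neumann : T `<=` krein_von_neumann T iota.
Proof.
move=> [g y] Tg; exists (iota y).
  by move=> _ _ [x [f Tf] [<- <-]] /=; rewrite (inner_iota Tf Tg).
by apply: sub_biadjoint; exists y; [exists g|].
Qed.

(** [Q] sends [g] to [iota (T g)], and by symmetry of [T] the adjoint of [Q] sends that to [T g]. *)
Lemma sub_friedrichs : T `<=` friedrichs T iota.
Proof.
move=> [g y] Tg; exists (iota y); first by apply: sub_biadjoint; exists (g, y).
move=> _ _ [[f z] Tf [/= <- <-]] /=; rewrite (inner_iota Tf Tg).
by case: T_pos => -[_ Tsym] _; exact: Tsym Tf Tg.
Qed.

Lemma dense_sub (U : topologicalType) (A B : set U) : A `<=` B -> dense A -> dense B.
Proof.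
move=> AB Ad O O0 Oo; have [x [Ox Ax]] := Ad O O0 Oo.
by exists x; split=> //; exact: AB.
Qed.

Lemma krein_von_neumann_selfadjoint : positive_selfadjoint (krein_von_neumann T iota).
Proof.
apply: (von_neumann scalars); apply: dense_sub T_dense => g [y Tg].
by have [e Je _] := sub_krein_von_neumann Tg; exists e.
Qed.

Lemma friedrichs_selfadjoint : positive_selfadjoint (friedrichs T iota).
Proof.
(* For [A = Q*], the identity [Q*** = Q*] turns [A** A*] into [Q* Q**]. *)
have := von_neumann scalars (A := adjoint (Q_op T iota)); rewrite triadjoint.
apply; apply: dense_sub T_dense => g [y Tg].
by have [e Qe _] := sub_friedrichs Tg; exists e.
Qed.

Variable S : set (H * H).
Hypotheses (S_pos : positive_selfadjoint S) (TS : T `<=` S).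

Lemma form_le_friedrichs : form_le S (friedrichs T iota).
Proof.
apply/(form_leP scalars S_pos friedrichs_selfadjoint) => h fs f Sfs [b Qfb Qbh].
apply: (energy_minimum Q_op_linear Qfb Qbh) => _ _ [[g y] Tg [/= <- <-]].
have [[[[_ SL _] Ssym] Sge0] _] := S_pos.
have Sg := TS Tg.
have Sa : S (fs - g, h - fs - y).
  by have := SL (-1) _ _ _ _ Sg Sfs; rewrite !scaleN1r ![- _ + _]addrC.
have := addr_ge0 (Sge0 _ _ Sa) (inner_ge0 (fs - g)); congr (_ <= _).
have yh : '[y, fs] = '[g, h] - '[g, fs] by rewrite (Ssym _ _ _ _ Sg Sfs) innerBr.
have hfs : '[h, fs] = '[fs, h].
  by have := Ssym _ _ _ _ Sfs Sfs; rewrite innerBl innerBr => /addIr.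
by rewrite (inner_iota Tg Tg) !innerE yh hfs; ring.
Qed.

Lemma krein_von_neumann_form_le : form_le (krein_von_neumann T iota) S.
Proof.
apply/(form_leP scalars krein_von_neumann_selfadjoint S_pos) => h f fs [e Jfe Jeh] Sfs.
have [[[[_ SL _] Ssym] Sge0] _] := S_pos.
(* Subtracting from [<h, h>] reverses the inequality and makes [h - f], the value of the Krein-von
   Neumann extension at [f], the minimiser for the inverse of [J]. *)
suff : '[h - f, h] <= '[h - fs, h].
  by rewrite !innerBl lerD2l lerN2.
apply: (energy_minimum inverse_J_op_linear (b := e)).
- by rewrite !adjoint_inverse.
- by rewrite adjoint_inverse /inverse /= opprB addrC subrK.
move=> _ _ [y [g Tg] [/= <- <-]].
have Sg := TS Tg.
have Sa : S (fs - g, h - fs - y).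
  by have := SL (-1) _ _ _ _ Sg Sfs; rewrite !scaleN1r ![- _ + _]addrC.
have := addr_ge0 (Sge0 _ _ Sa) (inner_ge0 (h - fs - y)); congr (_ <= _).
have yh : '[h, g] = '[fs, g] + '[fs, y].
  by have := Ssym _ _ _ _ Sfs Sg; rewrite innerBl => <-; rewrite addrC subrK.
by rewrite (inner_iota Tg Tg) !innerE yh; ring.
Qed.

End Extensions.
End Energy.

(** * The operator interval of extensions *)

Theorem corollary4p2 (R : realType) (K : numFieldType) (theta : K -> K)
    (scalars : real_or_complex R theta)
    (H : hilbertType theta) (T : set (H * H))
    (T_dense : densely_defined T) (T_pos : positive_operator T)
    (E : hilbertType theta) (iota : H -> E) (ET : energy_space T iota) :
  let TN := krein_von_neumann T iota in
  let TF := friedrichs T iota in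
  [/\ positive_selfadjoint_extension T TN,
      positive_selfadjoint_extension T TF,
      [set S | positive_selfadjoint_extension T S] = operator_interval TN TF
    & forall S : set (H * H), positive_selfadjoint S ->
        (T `<=` S <-> form_le TN S /\ form_le S TF)].
Proof.
move=> TN TF.
have TNsa := krein_von_neumann_selfadjoint scalars T_dense ET.
have TFsa := friedrichs_selfadjoint scalars T_dense T_pos ET.
have TTN : T `<=` TN := sub_krein_von_neumann ET.
have TTF : T `<=` TF := sub_friedrichs T_pos ET.
have interval S : positive_selfadjoint S -> T `<=` S <-> form_le TN S /\ form_le S TF.
  move=> Ssa; split=> [TS|[leN leF] [g y] Tg].
    split; first exact: (krein_von_neumann_form_le scalars).
    exact: (form_le_friedrichs scalars).
  have gy : g + y - g = y by rewrite addrC addKr.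
  have [f Sf] := add_identity_surj scalars (g + y) Ssa.
  have TNg : TN (g, g + y - g) by rewrite gy; exact: TTN.
  have TFg : TF (g, g + y - g) by rewrite gy; exact: TTF.
  have fg : f = g.
    apply: (form_le_resolvent_eq scalars leF Sf TFg); apply: le_anti.
    rewrite ((form_leP scalars TNsa Ssa).1 leN _ _ _ TNg Sf).
    by rewrite ((form_leP scalars Ssa TFsa).1 leF _ _ _ Sf TFg).
  by move: Sf; rewrite fg gy.
split=> //; apply/seteqP; split=> S.
  by move=> [Ssa TS]; have [leN leF] := (interval S Ssa).1 TS; case: Ssa.
move=> [_ leN leF]; have [_ Ssa _] := leN.
by split=> //; apply/(interval S Ssa).
Qed.
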